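(* Let $I$ be a bounded interval in $\mathbb{R}$ and let $f\in C^1(\bar I)$ satisfy $f\ge C>0$ in $I$ for some constant $C$. Let $(\lambda_n)_n$ be positive numbers with $\lambda_n\to\lambda\in[0,\lambda^*]$ and let $u_n$ be a solution of $(S)_{\lambda_n}$ on $\Omega=I$. Assume that there is $k_0\in\mathbb{N}$ such that $\mu_{k,\lambda_n}(u_n)\ge0$ for every $n\in\mathbb{N}$ and every $k\ge k_0$. If $\lambda>0$, then $\sup_{n\in\mathbb{N}}\|u_n\|_\infty<1$.
   Context: For $\lambda>0$ and $I=(a,b)$, problem $(S)_\lambda$ on $I$ is: $-\ddot u=\frac{\lambda f(x)}{(1-u)^2}$ in $I$, $0<u<1$ in $I$, $u(a)=u(b)=0$; solutions are understood in the classical sense. $\lambda^*\in(0,\infty)$ is the critical value such that $(S)_\lambda$ has a solution for $0<\lambda<\lambda^*$ and no solution for $\lambda>\lambda^*$. For a solution $u$ of $(S)_\lambda$, $\mu_{k,\lambda}(u)$ denotes the $k$-th Dirichlet eigenvalue (counted with multiplicity) of the linearized operator $L_{u,\lambda}\phi=-\ddot\phi-\frac{2\lambda f(x)}{(1-u)^3}\phi$ on $I$. *)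

(* Defs.v *)
From Stdlib Require Import Reals.
From Coquelicot Require Import Coquelicot.
Open Scope R_scope.

(* All functions are total on R; only their values on [a,b] matter. *)

(* C^2(I) for the open interval I = (a,b). *)
Definition C2_open (a b : R) (u : R -> R) : Prop :=
  forall x, a < x < b ->
    ex_derive u x /\ ex_derive (Derive u) x /\ continuous (Derive (Derive u)) x.

Definition C0_closed (a b : R) (u : R -> R) : Prop :=
  continuous_on (fun x => a <= x <= b) u.

(* C^1 up to the boundary: f and f' extend continuously to [a,b]. *)
Definition C1_closed (a b : R) (f : R -> R) : Prop :=
  C0_closed a b f /\
  exists df : R -> R,
    C0_closed a b df /\ forall x, a < x < b -> is_derive f x (df x).

(* Classical solutions of (S)_lambda on (a,b): u in C^2(I) and C(closure of I). *)
Definition S_solution (a b : R) (f : R -> R) (lambda : R) (u : R -> R) : Prop :=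
  C2_open a b u /\ C0_closed a b u /\
  (forall x, a < x < b ->
     - Derive (Derive u) x = lambda * f x / (1 - u x) ^ 2) /\
  (forall x, a < x < b -> 0 < u x < 1) /\
  u a = 0 /\ u b = 0.

Definition critical_value (a b : R) (f : R -> R) (lstar : R) : Prop :=
  0 < lstar /\
  (forall lambda, 0 < lambda < lstar -> exists u, S_solution a b f lambda u) /\
  (forall lambda, lstar < lambda -> ~ exists u, S_solution a b f lambda u).

(* phi lies in the mu-eigenspace of L_{u,lambda} with Dirichlet conditions;
   phi = 0 is allowed here. For a solution u the potential is continuous on
   [a,b], so classical and weak eigenfunctions coincide. *)
Definition in_eigenspace (a b : R) (f : R -> R) (lambda : R) (u : R -> R)
    (mu : R) (phi : R -> R) : Prop :=
  C2_open a b phi /\ C0_closed a b phi /\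
  (forall x, a < x < b ->
     - Derive (Derive phi) x - 2 * lambda * f x / (1 - u x) ^ 3 * phi x
     = mu * phi x) /\
  phi a = 0 /\ phi b = 0.

(* Linear independence of phi 1, ..., phi k as functions on (a,b). *)
Definition lin_indep (a b : R) (k : nat) (phi : nat -> R -> R) : Prop :=
  forall c : nat -> R,
    (forall x, a < x < b -> sum_n_m (fun i => c i * phi i x) 1 k = 0) ->
    forall i, (1 <= i <= k)%nat -> c i = 0.

(* At least k eigenvalues of L_{u,lambda}, counted with multiplicity, are <= t.
   Eigenspaces of distinct eigenvalues are independent, so the sum of the
   dimensions of those with eigenvalue <= t is the largest number of linearly
   independent eigenfunctions with eigenvalue <= t. *)
Definition eigenvalues_le (a b : R) (f : R -> R) (lambda : R) (u : R -> R)
    (k : nat) (t : R) : Prop :=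
  exists (nu : nat -> R) (phi : nat -> R -> R),
    (forall i, (1 <= i <= k)%nat ->
       nu i <= t /\ in_eigenspace a b f lambda u (nu i) (phi i)) /\
    lin_indep a b k phi.

(* The k-th smallest eigenvalue (k >= 1) counted with multiplicity. The infimum
   is attained, the spectrum being discrete and bounded below. For k = 0 the
   value is m_infty and has no meaning. *)
Definition dirichlet_eigenvalue (a b : R) (f : R -> R) (lambda : R)
    (u : R -> R) (k : nat) : Rbar :=
  Glb_Rbar (eigenvalues_le a b f lambda u k).

Definition sup_norm (a b : R) (u : R -> R) : Rbar :=
  Lub_Rbar (fun y => exists x, a < x < b /\ y = Rabs (u x)).

(* Main.v *)
Require Import Defs.
From Stdlib Require Import Reals Lra.
From Coquelicot Require Import Coquelicot.
Open Scope R_scope.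

(* A solution has energy [E = u'^2/2 + lambda f/(1-u)], and the equation gives
    [E' = lambda f'/(1-u)], so that [|E'| <= K E] with [K = sup |f'| / inf f];
    by Gronwall the values of [E] at any two points are comparable. As [u] is
    concave with values in [(0,1)], its slope is bounded away from the endpoints,
    and the mean value theorem for [u'] yields an interior point [y] where [-u'']
    is bounded, hence where [1/(1-u)] is bounded. So [E y] is bounded, and then so
    is [1/(1-u) <= E / (lambda inf f)] everywhere, uniformly for [lambda] bounded
    away from [0]. *)

(** * Calculus on an interval *)

Lemma C0_closed_bounded (a b : R) (g : R -> R) :
  a < b -> C0_closed a b g ->
  exists M, 0 < M /\ forall x, a < x < b -> Rabs (g x) <= M.
Proof.
intros hab hg.
(* Continuity of [g] is only relative to [[a,b]], while [bounded_continuity] asks for full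
   neighbourhoods. Composing with the 1-Lipschitz retraction [cl] onto [[a,b]] bridges the gap and
   leaves the values on [(a,b)] unchanged. *)
set (cl := fun x => Rmax a (Rmin b x)).
assert (hcl : forall x, a <= cl x <= b).
{ intros x; unfold cl, Rmax, Rmin.
  destruct (Rle_dec b x);
  match goal with |- context [Rle_dec ?p ?q] => destruct (Rle_dec p q) end; lra. }
assert (hcont : forall x, filterlim (fun t => g (cl t)) (locally x) (locally (g (cl x)))).
{ intros x; apply filterlim_comp with (G := within (fun x => a <= x <= b) (locally (cl x))).
  - intros P [e he]; exists e; intros y hy; apply he; [|apply hcl].
    revert hy; unfold ball; simpl; unfold AbsRing_ball, abs, minus, plus, opp; simpl.
    intro hy; apply Rle_lt_trans with (2 := hy).
    unfold cl, Rmax, Rmin.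
    destruct (Rle_dec b x), (Rle_dec b y);
    repeat (match goal with |- context [Rle_dec ?p ?q] => destruct (Rle_dec p q) end);
    unfold Rabs;
    repeat (match goal with |- context [Rcase_abs ?p] => destruct (Rcase_abs p) end); lra.
  - apply hg, hcl. }
destruct (bounded_continuity (fun t => g (cl t)) a b (fun x _ => hcont x)) as [M hM].
assert (hM' : forall x, a < x < b -> Rabs (g x) < M).
{ intros x hx; specialize (hM x (conj (Rlt_le _ _ (proj1 hx)) (Rlt_le _ _ (proj2 hx)))).
  replace (cl x) with x in hM; [exact hM|].
  unfold cl; rewrite Rmin_right, Rmax_right; lra. }
exists M; split.
- apply Rle_lt_trans with (2 := hM' ((a + b) / 2) ltac:(lra)), Rabs_pos.
- intros x hx; apply Rlt_le, hM', hx.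
Qed.

Lemma mvt_open (a b : R) (g dg : R -> R) :
  (forall x, a < x < b -> is_derive g x (dg x)) ->
  forall x y, a < x -> x < y -> y < b ->
  exists z, x < z < y /\ g y - g x = dg z * (y - x).
Proof.
intros hg x y hx hxy hy.
destruct (MVT_cor2 g dg x y hxy) as [z [hz1 hz2]].
- intros c hc; apply is_derive_Reals, hg; lra.
- exists z; split; assumption.
Qed.

Lemma nondecreasing_of_derive_nonneg (a b : R) (g dg : R -> R) :
  (forall x, a < x < b -> is_derive g x (dg x)) ->
  (forall x, a < x < b -> 0 <= dg x) ->
  forall x y, a < x -> x <= y -> y < b -> g x <= g y.
Proof.
intros hg hpos x y hx [hxy | <-] hy; [|lra].
destruct (mvt_open a b g dg hg x y hx hxy hy) as [z [hz e]].
assert (0 <= dg z * (y - x)) by (apply Rmult_le_pos; [apply hpos|]; lra).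
lra.
Qed.

(** Since [- K E <= E' <= K E], the weighted function [exp (K t) * E t] is nondecreasing and
    [exp (- K t) * E t] is nonincreasing. The first serves when [x <= y], the second when
    [y < x]. *)
Lemma gronwall_two_sided (a b K : R) (E dE : R -> R) :
  0 <= K ->
  (forall x, a < x < b -> is_derive E x (dE x)) ->
  (forall x, a < x < b -> Rabs (dE x) <= K * E x) ->
  (forall x, a < x < b -> 0 <= E x) ->
  forall x y, a < x < b -> a < y < b -> E x <= exp (K * (b - a)) * E y.
Proof.
intros hK hE hdE hE0.
(* Both weights at once: [k] is [K] or [- K], and its sign decides the direction of monotonicity. *)
assert (hw : forall k x y, Rabs k = K -> a < x -> x <= y -> y < b ->
  (0 <= k -> exp (k * x) * E x <= exp (k * y) * E y) /\
  (k <= 0 -> exp (k * y) * E y <= exp (k * x) * E x)).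
{ intros k x y hk hx hxy hy.
  assert (hd : forall t, a < t < b ->
    is_derive (fun t => exp (k * t) * E t) t (exp (k * t) * (k * E t + dE t))).
  { intros t ht; specialize (hE t ht).
    auto_derive; [exists (dE t); exact hE|].
    replace (Derive (fun x0 => E x0) t) with (dE t)
      by (symmetry; exact (is_derive_unique _ _ _ hE)); ring. }
  split; intros hs.
  - apply (nondecreasing_of_derive_nonneg a b _ _ hd); auto.
    intros t ht; apply Rmult_le_pos; [apply Rlt_le, exp_pos|].
    specialize (hdE t ht); apply Rabs_le_between in hdE.
    rewrite Rabs_pos_eq in hk by lra; rewrite hk; lra.
  - apply Ropp_le_cancel.
    apply (nondecreasing_of_derive_nonneg a b (fun t => - (exp (k * t) * E t))
      (fun t => - (exp (k * t) * (k * E t + dE t)))); auto.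
    + intros t ht; apply (is_derive_opp (fun t => exp (k * t) * E t)), hd, ht.
    + intros t ht.
      replace (- (exp (k * t) * (k * E t + dE t)))
        with (exp (k * t) * ((- k) * E t - dE t)) by ring.
      apply Rmult_le_pos; [apply Rlt_le, exp_pos|].
      specialize (hdE t ht); apply Rabs_le_between in hdE.
      rewrite Rabs_left1 in hk by lra; rewrite hk; lra. }
assert (hexp : forall k x y, k * (y - x) <= K * (b - a) -> a < x < b -> a < y < b ->
  exp (k * x) * E x <= exp (k * y) * E y -> E x <= exp (K * (b - a)) * E y).
{ intros k x y hk hx hy h.
  apply Rmult_le_reg_l with (exp (k * x)); [apply exp_pos|].
  apply Rle_trans with (1 := h).
  rewrite <- Rmult_assoc, <- exp_plus.
  apply Rmult_le_compat_r; [apply hE0, hy|].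
  destruct (Rle_lt_or_eq_dec (k * y) (k * x + K * (b - a))) as [e|e]; [lra| |].
  - apply Rlt_le, exp_increasing, e.
  - rewrite e; lra. }
intros x y hx hy; destruct (Rle_or_lt x y) as [hxy|hxy].
- apply (hexp K); auto.
  + apply Rmult_le_compat_l; lra.
  + apply (proj1 (hw K x y (Rabs_pos_eq K hK) ltac:(lra) ltac:(lra) ltac:(lra))); lra.
- apply (hexp (- K)); auto.
  + replace (- K * (y - x)) with (K * (x - y)) by ring; apply Rmult_le_compat_l; lra.
  + assert (e : Rabs (- K) = K) by (rewrite Rabs_Ropp; apply Rabs_pos_eq, hK).
    apply (proj2 (hw (- K) y x e ltac:(lra) ltac:(lra) ltac:(lra))); lra.
Qed.

(** * Estimates for a single solution *)

Section Solution.

Variables (a b : R) (f df : R -> R) (m F D : R).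
Hypotheses (hab : a < b) (hm : 0 < m) (hD : 0 <= D)
  (hfm : forall x, a < x < b -> m <= f x)
  (hfF : forall x, a < x < b -> f x <= F)
  (hdf : forall x, a < x < b -> is_derive f x (df x))
  (hdfD : forall x, a < x < b -> Rabs (df x) <= D).

Variables (lambda : R) (u : R -> R).
Hypotheses (hl : 0 < lambda) (hu : S_solution a b f lambda u).

Let energy (x : R) : R := Derive u x ^ 2 / 2 + lambda * f x / (1 - u x).

Lemma solution_lt1 x : a < x < b -> 0 < 1 - u x.
Proof. intros hx; destruct hu as (_ & _ & _ & h & _); specialize (h x hx); lra. Qed.

Lemma derive_solution x : a < x < b -> is_derive u x (Derive u x).
Proof. intros hx; apply Derive_correct, hu, hx. Qed.

Lemma derive2_solution x :
  a < x < b -> is_derive (Derive u) x (- (lambda * f x / (1 - u x) ^ 2)).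
Proof.
intros hx; destruct hu as (h2 & _ & he & _).
rewrite <- he, Ropp_involutive by exact hx; apply Derive_correct, h2, hx.
Qed.

(** The term [u' u''] cancels [lambda f u' / (1 - u)^2] by the equation, so only the variation of
    [f] remains. *)
Lemma derive_energy x :
  a < x < b -> is_derive energy x (lambda * df x / (1 - u x)).
Proof.
intros hx; unfold energy.
assert (h0 := solution_lt1 x hx); assert (h1 := derive_solution x hx).
assert (h2 := derive2_solution x hx); assert (h3 := hdf x hx).
set (v := Derive u) in *.
auto_derive.
- repeat split; try (eexists; eassumption); lra.
- replace (Derive (fun t => u t) x) with (v x) by reflexivity.
  replace (Derive (fun t => v t) x) with (- (lambda * f x / (1 - u x) ^ 2))
    by (symmetry; apply is_derive_unique, h2).
  replace (Derive (fun t => f t) x) with (df x)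
    by (symmetry; apply is_derive_unique, h3).
  field; lra.
Qed.

Lemma energy_lower x : a < x < b -> lambda * f x / (1 - u x) <= energy x.
Proof. intros hx; unfold energy; assert (h := pow2_ge_0 (Derive u x)); lra. Qed.

Lemma potential_pos x : a < x < b -> 0 < lambda * f x / (1 - u x).
Proof.
intros hx; apply Rdiv_lt_0_compat; [|apply solution_lt1, hx].
apply Rmult_lt_0_compat; [exact hl|]; specialize (hfm x hx); lra.
Qed.

Lemma energy_comparable x y :
  a < x < b -> a < y < b -> energy x <= exp (D / m * (b - a)) * energy y.
Proof.
assert (hK : 0 <= D / m) by (apply Rdiv_le_0_compat; lra).
apply (gronwall_two_sided a b (D / m) energy _ hK derive_energy).
- intros t ht.
  (* As [f >= m], one has [|f'| <= D <= D * (f / m)]; this makes the derivative of the energy at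
     most [D / m] times its potential part. *)
  apply Rle_trans with (D / m * (lambda * f t / (1 - u t)));
    [|apply Rmult_le_compat_l; [exact hK|apply energy_lower, ht]].
  assert (h0 := solution_lt1 t ht).
  unfold Rdiv at 1; rewrite !Rabs_mult, Rabs_inv.
  rewrite (Rabs_pos_eq lambda), (Rabs_pos_eq (1 - u t)) by lra.
  replace (D / m * (lambda * f t / (1 - u t)))
    with (lambda * (D * (f t / m)) * / (1 - u t)) by (field; lra).
  apply Rmult_le_compat_r; [apply Rlt_le, Rinv_0_lt_compat, h0|].
  apply Rmult_le_compat_l; [lra|].
  apply Rle_trans with (D * 1); [rewrite Rmult_1_r; apply hdfD, ht|].
  apply Rmult_le_compat_l; [exact hD|].
  apply Rle_div_r; [exact hm|]; specialize (hfm t ht); lra.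
- intros t ht; assert (h1 := energy_lower t ht).
  assert (h2 := potential_pos t ht); lra.
Qed.

Lemma derive_solution_antitone x y :
  a < x -> x <= y -> y < b -> Derive u y <= Derive u x.
Proof.
intros hx hxy hy; apply Ropp_le_cancel.
apply (nondecreasing_of_derive_nonneg a b (fun t => - Derive u t)
  (fun t => lambda * f t / (1 - u t) ^ 2)); auto.
- intros t ht.
  rewrite <- (Ropp_involutive (lambda * f t / (1 - u t) ^ 2)).
  apply (is_derive_opp (Derive u)), derive2_solution, ht.
- intros t ht; apply Rdiv_le_0_compat; [|apply pow_lt, solution_lt1, ht].
  apply Rmult_le_pos; [lra|]; specialize (hfm t ht); lra.
Qed.

(** By concavity, [u' y] lies between the slopes of the chords over [[y, y + h]] and [[y - h, y]].
    Each has absolute value below [/ h], because [u] varies by less than 1. *)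
Lemma interior_slope h y :
  0 < h -> a < y - h -> y + h < b -> Rabs (Derive u y) <= / h.
Proof.
intros hh ha hb.
assert (h01 : forall t, a < t < b -> 0 < u t < 1) by apply hu.
assert (mvt := mvt_open a b u (Derive u) derive_solution).
assert (hi : h * / h = 1) by (apply Rinv_r; lra).
apply Rabs_le_between; split.
- destruct (mvt y (y + h)) as [z [hz e]]; try lra.
  assert (h1 := derive_solution_antitone y z ltac:(lra) ltac:(lra) ltac:(lra)).
  assert (h2 := h01 y ltac:(lra)); assert (h3 := h01 (y + h) ltac:(lra)).
  apply Rmult_le_reg_r with h; [exact hh|].
  assert (Derive u z * h <= Derive u y * h) by (apply Rmult_le_compat_r; lra).
  replace (y + h - y) with h in e by ring; lra.
- destruct (mvt (y - h) y) as [z [hz e]]; try lra.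
  assert (h1 := derive_solution_antitone z y ltac:(lra) ltac:(lra) ltac:(lra)).
  assert (h2 := h01 y ltac:(lra)); assert (h3 := h01 (y - h) ltac:(lra)).
  apply Rmult_le_reg_r with h; [exact hh|].
  assert (Derive u y * h <= Derive u z * h) by (apply Rmult_le_compat_r; lra).
  replace (y - (y - h)) with h in e by ring; lra.
Qed.

(** The bound depends on [lambda] only through [/ lambda], and is nondecreasing in it; this is what
    makes it uniform along a sequence. *)
Lemma solution_gap x :
  a < x < b ->
  let h := (b - a) / 6 in
  / (1 - u x) <=
    exp (D / m * (b - a)) / m * (/ lambda * / h ^ 2 + F * (1 + / lambda * / (m * h ^ 2))).
Proof.
intros hx h.
assert (hh : 0 < h) by (unfold h; lra).
assert (hb : b = a + 6 * h) by (unfold h; field).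
(* With [h] a sixth of the length, these two points and [y] between them are all at distance more
   than [h] from the endpoints, so [interior_slope] applies to each. *)
destruct (mvt_open a b (Derive u) _ derive2_solution (a + 2 * h) (a + 4 * h))
  as [y [hy e]]; try lra.
assert (hy' : a < y < b) by lra.
assert (s1 := interior_slope h (a + 2 * h) hh ltac:(lra) ltac:(lra)).
assert (s2 := interior_slope h (a + 4 * h) hh ltac:(lra) ltac:(lra)).
assert (s3 := interior_slope h y hh ltac:(lra) ltac:(lra)).
apply Rabs_le_between in s1; apply Rabs_le_between in s2.
assert (v0 := solution_lt1 y hy'); assert (x0 := solution_lt1 x hx).
assert (fy := hfm y hy'); assert (fx := hfm x hx); assert (fF := hfF y hy').
set (w := / (1 - u y)).
assert (w0 : 0 < w) by (apply Rinv_0_lt_compat, v0).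
(* The slope drops by at most [2 / h] over a length [2 * h], so [- u'' y <= / h ^ 2]. *)
assert (hw2 : w ^ 2 <= / lambda * / (m * h ^ 2)).
{ apply Rmult_le_reg_l with (lambda * m); [apply Rmult_lt_0_compat; lra|].
  apply Rle_trans with (lambda * f y / (1 - u y) ^ 2).
  - replace (lambda * f y / (1 - u y) ^ 2) with (lambda * f y * w ^ 2)
      by (unfold w; field; lra).
    apply Rmult_le_compat_r; [apply pow2_ge_0|].
    apply Rmult_le_compat_l; lra.
  - apply Rmult_le_reg_r with (2 * h); [lra|].
    replace (lambda * m * (/ lambda * / (m * h ^ 2)) * (2 * h)) with (2 * / h)
      by (field; lra).
    replace (a + 4 * h - (a + 2 * h)) with (2 * h) in e by ring; lra. }
(* [w <= 1 + w ^ 2] avoids a square root. *)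
assert (hw : w <= 1 + / lambda * / (m * h ^ 2)).
{ assert (h1 := pow2_ge_0 (w - 1)); assert (0 <= w ^ 2) by apply pow2_ge_0.
  replace ((w - 1) ^ 2) with (w ^ 2 - 2 * w + 1) in h1 by ring; lra. }
assert (hEy : energy y <= / h ^ 2 + lambda * (F * (1 + / lambda * / (m * h ^ 2)))).
{ unfold energy; apply Rplus_le_compat.
  - apply pow_maj_Rabs with (n := 2%nat) in s3; rewrite pow_inv in s3.
    assert (0 <= Derive u y ^ 2) by apply pow2_ge_0; lra.
  - unfold Rdiv; rewrite Rmult_assoc; apply Rmult_le_compat_l; [lra|].
    fold w; apply Rmult_le_compat; lra. }
assert (hE := energy_comparable x y hx hy').
assert (hEx := energy_lower x hx).
(* Back to [x]: [lambda * m / (1 - u x)] is at most the energy at [x], which is compared with the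
   energy at [y]. *)
apply Rmult_le_reg_l with (lambda * m); [apply Rmult_lt_0_compat; lra|].
apply Rle_trans with (lambda * f x / (1 - u x)).
{ apply Rmult_le_compat_r; [apply Rlt_le, Rinv_0_lt_compat, x0|].
  apply Rmult_le_compat_l; lra. }
apply Rle_trans with (1 := hEx), Rle_trans with (1 := hE).
set (X := exp (D / m * (b - a))) in *.
apply Rle_trans with (1 := Rmult_le_compat_l X _ _ (Rlt_le _ _ (exp_pos _)) hEy).
right; field; lra.
Qed.

End Solution.

(** * Uniformity along the sequence *)

Theorem theorem1p6 (a b : R) (hab : a < b)
  (f : R -> R) (hf : C1_closed a b f)
  (hfC : exists C, 0 < C /\ forall x, a < x < b -> C <= f x)
  (lstar : R) (hstar : critical_value a b f lstar)
  (lam : nat -> R) (hlam_pos : forall n, 0 < lam n)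
  (l : R) (hl : 0 <= l <= lstar) (hlam : is_lim_seq lam l)
  (u : nat -> R -> R) (hu : forall n, S_solution a b f (lam n) (u n))
  (hmu : exists k0 : nat, forall n k : nat, (1 <= k)%nat -> (k0 <= k)%nat ->
     Rbar_le 0 (dirichlet_eigenvalue a b f (lam n) (u n) k))
  (hl_pos : 0 < l) :
  Rbar_lt (Sup_seq (fun n => sup_norm a b (u n))) 1.
Proof.
destruct hf as [hf0 [df [hdf0 hdf]]].
destruct hfC as [m [hm hfm]].
destruct (C0_closed_bounded a b f hab hf0) as [F [hF hfF]].
destruct (C0_closed_bounded a b df hab hdf0) as [D [hD hdfD]].
(* Here [l > 0] enters: [/ lam n] converges, hence is bounded over all [n]. *)
assert (hinv : is_lim_seq (fun n => / lam n) (/ l)).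
{ apply (is_lim_seq_inv lam l); [exact hlam|].
  intros e; injection e; lra. }
destruct (filterlim_bounded (fun n => / lam n) (ex_intro _ (/ l) hinv)) as [S hS].
assert (hS' : forall n, / lam n <= S).
{ intros n; apply Rle_trans with (2 := hS n), Rle_abs. }
set (h := (b - a) / 6).
assert (hh : 0 < h) by (unfold h; lra).
assert (h2 : 0 < / h ^ 2) by (apply Rinv_0_lt_compat, pow_lt, hh).
assert (h3 : 0 < / (m * h ^ 2)).
{ apply Rinv_0_lt_compat, Rmult_lt_0_compat; [exact hm|apply pow_lt, hh]. }
(* The bound of [solution_gap] with [/ lam n] replaced by its upper bound [S]. *)
set (B := exp (D / m * (b - a)) / m * (S * / h ^ 2 + F * (1 + S * / (m * h ^ 2)))).
assert (hB : forall n x, a < x < b -> / (1 - u n x) <= B).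
{ intros n x hx.
  assert (g := solution_gap a b f df m F D hab hm (Rlt_le _ _ hD) hfm
    (fun t ht => Rle_trans _ _ _ (Rle_abs _) (hfF t ht)) hdf hdfD
    (lam n) (u n) (hlam_pos n) (hu n) x hx).
  apply Rle_trans with (1 := g); fold h.
  apply Rmult_le_compat_l; [apply Rlt_le, Rdiv_lt_0_compat; [apply exp_pos|exact hm]|].
  apply Rplus_le_compat.
  - apply Rmult_le_compat_r; [lra|apply hS'].
  - apply Rmult_le_compat_l; [lra|]; apply Rplus_le_compat_l.
    apply Rmult_le_compat_r; [lra|apply hS']. }
assert (h01 : forall n x, a < x < b -> 0 < u n x < 1) by (intros n; apply hu).
assert (hBpos : 0 < B).
{ assert (hc : a < (a + b) / 2 < b) by lra.
  apply Rlt_le_trans with (2 := hB 0%nat _ hc), Rinv_0_lt_compat.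
  specialize (h01 0%nat _ hc); lra. }
(* [/ (1 - u n x) <= B] means [u n x <= 1 - / B], a bound independent of [n] and [x], and strictly
   below 1 since [B > 0]. *)
apply Rbar_le_lt_trans with (1 - / B).
- apply (proj2 (is_sup_seq_lub _ _ (Sup_seq_correct _))).
  intros s [n ->].
  apply (proj2 (Lub_Rbar_correct _)).
  intros y [x [hx ->]]; simpl.
  specialize (h01 n x hx); specialize (hB n x hx).
  rewrite Rabs_pos_eq by lra.
  apply Rinv_le_contravar in hB; [|apply Rinv_0_lt_compat; lra].
  rewrite Rinv_inv in hB; lra.
- simpl; assert (0 < / B) by (apply Rinv_0_lt_compat, hBpos); lra.
Qed.
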